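(* $V_4=\displaystyle\inf_{a\in[1.5597515,\,2\cos\frac{\pi}{6}]}\frac{p_2(a)}{(\sqrt a-1)^2}=34.8992259$. The infimum is attained at the point $p=(0.2114174,0.5028452,0.6363167,0.5028451,0.2114174)\in\mathbb{R}^5$, which corresponds to the cosine polynomial $f(\phi)=\sum_{k=0}^4 a_k\cos k\phi\in C_4$ with $a_0=1$, $a_1=1.7051159$, $a_2=1.0438202$, $a_3=0.4252409$, $a_4=0.0893946$.
   Context: For an integer $n\ge 2$, $C_n$ denotes the set of real cosine polynomials $f(\phi)=\sum_{k=0}^{n} a_k\cos(k\phi)$ such that (i) all coefficients are real and nonnegative, (ii) $a_1>a_0>0$, and (iii) $f(\phi)\ge 0$ for all real $\phi$. For $f\in C_n$, $v(f)=\dfrac{f(0)-a_0}{(\sqrt{a_1}-\sqrt{a_0})^2}$ and $V_n=\inf_{f\in C_n}v(f)$. For real $a$, $p_2(a)$ is the minimum of $F(\mathbf x)=(x_0+x_1+x_2+x_3+x_4)^2-1$ over $\mathbf x=(x_0,\dots,x_4)\in\mathbb{R}^5$ subject to $\sum_{i=0}^4x_i^2=1$ and $2(x_0x_1+x_1x_2+x_2x_3+x_3x_4)=a$. A point $\mathbf x\in\mathbb{R}^5$ corresponds to the cosine polynomial $|\sum_{k=0}^4 x_k e^{ik\phi}|^2=a_0+\sum_{j\ge1}a_j\cos j\phi$ with $a_0=\sum_k x_k^2$ and $a_j=2\sum_{k}x_kx_{k+j}$. Numerical constants are decimal values as given in the paper, to seven decimal places. *)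

(* Defs.v *)
(* MathComp-Analysis, over an arbitrary [R : realType]. *)
From HB Require Import structures.
From mathcomp Require Import all_boot all_order all_algebra.
From mathcomp Require Import all_classical all_reals all_analysis.
From mathcomp Require Import complex ring.
Set Implicit Arguments.
Unset Strict Implicit.
Unset Printing Implicit Defensive.
Import Order.TTheory GRing.Theory Num.Theory.
Local Open Scope classical_set_scope.
Local Open Scope ring_scope.

Section CosinePolynomials.
Variable R : realType.

(* A cosine polynomial sum_(k <= n) a_k cos(k phi) is given by its coefficient
   vector (a_0, .., a_n), which the function determines uniquely. *)
Definition cos_eval (n : nat) (a : 'rV[R]_n.+1) (phi : R) : R :=
  \sum_(k < n.+1) a 0 k * cos (k%:R * phi).

(* [inord 1] is the index 1 as soon as n >= 1; the class C_n is only meant for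
   n >= 2. *)
Definition coef1 (n : nat) (a : 'rV[R]_n.+1) : R := a 0 (inord 1).

Definition Cn (n : nat) : set 'rV[R]_n.+1 :=
  [set a : 'rV[R]_n.+1 |
    [/\ forall k, 0 <= a 0 k,
        0 < a 0 0 /\ a 0 0 < coef1 a
      & forall phi, 0 <= cos_eval a phi]].
Arguments Cn : clear implicits.

Definition vn (n : nat) (a : 'rV[R]_n.+1) : R :=
  (cos_eval a 0 - a 0 0) / (Num.sqrt (coef1 a) - Num.sqrt (a 0 0)) ^+ 2.

(* [inf] is a greatest lower bound only for a nonempty set that is bounded
   below, and is 0 otherwise. *)
Definition Vn (n : nat) : R := inf [set vn a | a in Cn n].

Definition F (x : 'rV[R]_5) : R := (\sum_(i < 5) x 0 i) ^+ 2 - 1.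

Definition feasible (a : R) : set 'rV[R]_5 :=
  [set x : 'rV[R]_5 |
    \sum_(i < 5) x 0 i ^+ 2 = 1 /\
    2 * (x 0 0 * x 0 1 + x 0 1 * x 0 2 + x 0 2 * x 0 3 + x 0 3 * x 0 4) = a].

(* The minimum, not merely the infimum, of F over the feasible points; it is
   0 if there is no minimum. *)
Definition p2 (a : R) : R :=
  xget 0 [set m | (F @` feasible a) m /\ lbound (F @` feasible a) m].

(* a_0 = sum_k x_k^2 and a_j = 2 sum_k x_k x_(k+j) for j >= 1. *)
Definition cospoly_of (n : nat) (x : 'rV[R]_n.+1) : 'rV[R]_n.+1 :=
  \row_(j < n.+1) ((if j == 0 then 1 else 2) *
    \sum_(k < n.+1) \sum_(l < n.+1 | l == (k + j)%N :> nat) x 0 k * x 0 l).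

Lemma cospoly_ofE (n : nat) (x : 'rV[R]_n.+1) (phi : R) :
  cos_eval (cospoly_of x) phi =
  ComplexField.Normc.normc (\sum_(k < n.+1)
    (x 0 k)%:C * (cos (k%:R * phi) +i* sin (k%:R * phi)))%C ^+ 2.
Proof.
pose c (k : nat) := cos (k%:R * phi : R); pose s (k : nat) := sin (k%:R * phi : R).
have normcE (z : R[i]) : ComplexField.Normc.normc z ^+ 2 =
    complex.Re z ^+ 2 + complex.Im z ^+ 2.
  by case: z => a b /=; rewrite sqr_sqrtr // addr_ge0 // sqr_ge0.
have ReE : complex.Re (\sum_(k < n.+1)
    (x 0 k)%:C * (cos (k%:R * phi) +i* sin (k%:R * phi)))%C
    = \sum_(k < n.+1) x 0 k * c k.
  rewrite (raddf_sum (@complex.Re R)).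
  by apply: eq_bigr => k _ /=; rewrite mul0r subr0.
have ImE : complex.Im (\sum_(k < n.+1)
    (x 0 k)%:C * (cos (k%:R * phi) +i* sin (k%:R * phi)))%C
    = \sum_(k < n.+1) x 0 k * s k.
  rewrite (raddf_sum (@complex.Im R)).
  by apply: eq_bigr => k _ /=; rewrite mul0r addr0.
rewrite normcE ReE ImE.
pose T (k l : 'I_n.+1) := x 0 k * x 0 l * (c k * c l + s k * s l).
have -> : (\sum_(k < n.+1) x 0 k * c k) ^+ 2 + (\sum_(k < n.+1) x 0 k * s k) ^+ 2
   = \sum_(k < n.+1) \sum_(l < n.+1) T k l.
  rewrite !expr2 !mulr_suml -big_split /=; apply: eq_bigr => k _.
  rewrite !mulr_sumr -big_split /=; apply: eq_bigr => l _.
  by rewrite /T; ring.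
have TC k l : T k l = T l k by rewrite /T; ring.
have Tle (k l : 'I_n.+1) (j : nat) : l = (k + j)%N :> nat ->
    x 0 k * x 0 l * cos (j%:R * phi) = T k l.
  move=> e; rewrite /T; congr (_ * _).
  have -> : j%:R * phi = l%:R * phi - k%:R * phi by rewrite e natrD; ring.
  by rewrite cosB /c /s; ring.
have -> : \sum_(k < n.+1) \sum_(l < n.+1) T k l =
  \sum_(k < n.+1) \sum_(l < n.+1 | (k <= l)%N) (if l == k then 1 else 2) * T k l.
  have split2 (k : 'I_n.+1) : \sum_(l < n.+1) T k l =
      \sum_(l < n.+1 | (k <= l)%N) T k l + \sum_(l < n.+1 | (l < k)%N) T k l.
    rewrite (bigID (fun l : 'I_n.+1 => (k <= l)%N)) /=; congr (_ + _).
    by apply: eq_bigl => l; rewrite -ltnNge.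
  rewrite (eq_bigr _ (fun k _ => split2 k)) big_split /=.
  have -> : \sum_(k < n.+1) \sum_(l < n.+1 | (l < k)%N) T k l =
            \sum_(k < n.+1) \sum_(l < n.+1 | (k < l)%N) T k l.
    rewrite (exchange_big_dep predT) //=.
    by apply: eq_bigr => k _; apply: eq_bigr => l _; exact: TC.
  rewrite -big_split /=; apply: eq_bigr => k _.
  rewrite (bigD1 k) //= [RHS](bigD1 k) //= eqxx mul1r -addrA; congr (_ + _).
  have lt_eq (l : 'I_n.+1) : (k < l)%N = (k <= l)%N && (l != k).
    by rewrite ltn_neqAle andbC eq_sym.
  rewrite [X in _ + X](eq_bigl _ _ lt_eq) -big_split /=.
  by apply: eq_bigr => l /andP[_ /negPf ->]; ring.
rewrite /cos_eval.
transitivity (\sum_(j < n.+1) \sum_(k < n.+1)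
    \sum_(l < n.+1 | l == (k + j)%N :> nat) (if l == k then 1 else 2) * T k l).
  apply: eq_bigr => j _; rewrite mxE -mulrA mulr_suml mulr_sumr.
  apply: eq_bigr => k _; rewrite mulr_suml mulr_sumr.
  apply: eq_bigr => l /eqP e; rewrite (Tle _ _ _ e).
  suff -> : (l == k) = (j == 0) by [].
  by rewrite -!val_eqE /= e -[X in _ == X]addn0 eqn_add2l.
rewrite exchange_big /=; apply: eq_bigr => k _.
rewrite (exchange_big_dep (fun l : 'I_n.+1 => (k <= l)%N)) /=; last first.
  by move=> j l _ /eqP ->; exact: leq_addr.
apply: eq_bigr => l kl.
have ltn : (l - k < n.+1)%N by apply: leq_ltn_trans (ltn_ord l); exact: leq_subr.
rewrite (big_pred1 (Ordinal ltn)) // => j /=.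
rewrite -val_eqE /=.
by apply/eqP/eqP => [->|->]; rewrite ?addKn ?subnKC.
Qed.

(* Seven-place decimals: dec7 15597515 is 1.5597515, and dec7 1 is one unit in
   the last place. *)
Definition dec7 (N : nat) : R := N%:R / 10 ^+ 7.

End CosinePolynomials.

Arguments Cn : clear implicits.

(* Main.v *)
(* If f >= 0 has degree 4, then for rho in [1/sqrt 3, 1]
     (3 rho^2 - 1) f(0) >= S(rho) (rho a_1 - a_0),
   because the difference of the two sides is a nonnegative combination of two
   values of f: the corresponding Toeplitz form is positive semidefinite and
   singular, and its kernel polynomial has only two zeros in cos phi.  No
   Fejer-Riesz factorization is needed.  The kernel vector, rational in rho,
   gives a point of R^5 where equality holds, so these points realize p_2(a) for
   a in [5/3, sqrt 3], with a = C(rho)/N(rho) and p_2(a) = S(rho)^2/N(rho) - 1.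
   For a <= 5/3 the bounds f(0) >= 6 a - 6 (rho = 1) and, when a <= 3/2,
   f(0) >= 2 a (from f(pi) >= 0 and a_3 >= 0) already give more than V_4.
   What remains is to minimize (S^2/N - 1) / (sqrt(C/N) - 1)^2 over rho: the
   inequality "at least v" amounts to a polynomial inequality of degree 8, whose
   Taylor expansion at a rational approximation of the minimizer confines both
   the minimizer and the minimum. *)

Require Import Defs.
From mathcomp Require Import all_boot all_order all_algebra.
From mathcomp Require Import all_classical all_reals all_analysis.
From mathcomp Require Import ring lra.
Set Implicit Arguments.
Unset Strict Implicit.
Unset Printing Implicit Defensive.
Import Order.TTheory GRing.Theory Num.Theory.
Local Open Scope classical_set_scope.
Local Open Scope ring_scope.

Lemma sum5 (V : nmodType) (g : 'I_5 -> V) :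
  \sum_(i < 5) g i = g 0 + g 1 + g 2 + g 3 + g 4.
Proof.
rewrite !big_ord_recr big_ord0 /= add0r.
by congr (_ + _ + _ + _ + _); congr (g _); apply/val_inj.
Qed.

(** * Duality: lower bounds on [f(0)] from two values of [f] *)

Section DualBound.
Variable R : realType.
Implicit Types (a : 'rV[R]_5) (rho c phi : R).

Lemma cos_eval5 a phi : cos_eval a phi =
  a 0 0 + a 0 1 * cos phi + a 0 2 * cos (2 * phi) + a 0 3 * cos (3 * phi)
  + a 0 4 * cos (4 * phi).
Proof. by rewrite /cos_eval sum5 /= mul0r cos0 mulr1 mul1r. Qed.

(** At [phi = acos c] each [cos (k * phi)] is a Chebyshev polynomial in [c], so [f] can be evaluated
    at cosines given algebraically. *)
Lemma chebyshev5_ge0 a c : (forall phi, 0 <= cos_eval a phi) -> -1 <= c <= 1 ->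
  0 <= a 0 0 + a 0 1 * c + a 0 2 * (2 * c ^+ 2 - 1)
       + a 0 3 * (4 * c ^+ 3 - 3 * c) + a 0 4 * (8 * c ^+ 4 - 8 * c ^+ 2 + 1).
Proof.
move=> a_ge0 cI; have := a_ge0 (acos c); rewrite cos_eval5.
have cK : cos (acos c) = c by rewrite acosK.
have c2 : cos (2 * acos c) = 2 * c ^+ 2 - 1.
  by rewrite mulr_natl cos_mulr2n cK; ring.
have c3 : cos (3 * acos c) = 4 * c ^+ 3 - 3 * c.
  have -> : 3 * acos c = 2 * acos c + acos c by ring.
  rewrite cosD c2 cK [X in sin X]mulr_natl sin_mulr2n cK.
  have := sin2cos2 (acos c); rewrite cK => s2.
  have -> : c * sin (acos c) *+ 2 * sin (acos c) = 2 * c * sin (acos c) ^+ 2 by ring.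
  by rewrite s2; ring.
have c4 : cos (4 * acos c) = 8 * c ^+ 4 - 8 * c ^+ 2 + 1.
  have -> : 4 * acos c = (2 * acos c) *+ 2 by ring.
  by rewrite cos_mulr2n c2; ring.
by rewrite cK c2 c3 c4.
Qed.

(* The sum of the coordinates, the squared norm and the coefficient [a_1] for the
   vector (p, q, s, q, p) with [p = 1 + rho - rho ^+ 2], [q = 1 + 2 * rho],
   [s = (1 + rho) ^+ 2]. *)
Definition sumpoly rho : R := 5 + 8 * rho - rho ^+ 2.
Definition normpoly rho : R := 3 * rho ^+ 4 + 12 * rho ^+ 2 + 16 * rho + 5.
Definition coefpoly rho : R := 24 * rho ^+ 2 + 28 * rho + 8.

(* [u] and [v] are the cosines of the zeros of the kernel polynomial, [w] and [z]
   the weights; the moments of order at least 2 follow from the quadratic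
   equation of [u] and [v]. *)
Lemma dual_bound a rho : (forall phi, 0 <= cos_eval a phi) ->
  0 <= rho <= 1 -> 1 <= 3 * rho ^+ 2 ->
  sumpoly rho * (rho * a 0 1 - a 0 0) <= (3 * rho ^+ 2 - 1) * cos_eval a 0.
Proof.
move=> a_ge0 /andP[r0 r1] rk.
pose p := 1 + rho - rho ^+ 2; pose q := 1 + 2 * rho; pose k := 3 * rho ^+ 2 - 1.
(* These are the coefficients of [a_0] and [a_1] in the difference of the two sides, hence the
   moments of order 0 and 1 required of the weights. *)
pose m0 := k + sumpoly rho; pose m1 := k - rho * sumpoly rho.
have p0 : 0 < p by rewrite /p; nra.
have q0 : 0 < q by rewrite /q; nra.
have k0 : 0 <= k by rewrite /k; nra.
have S0 : 0 < sumpoly rho by rewrite /sumpoly; nra.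
(* A quarter of the discriminant of [4 * p * t ^+ 2 + 2 * q * t + k], whose roots are [u] and [v];
   [eq_] and [ep] will keep these in [[-1, 1]]. *)
pose D := q ^+ 2 - 4 * p * k.
have D0 : 0 < D.
  rewrite /D /q /p /k.
  have : 0 <= (1 - rho) * rho by nra.
  have : 0 <= (1 - rho) * rho ^+ 3 by rewrite mulr_ge0 ?exprn_ge0 // subr_ge0.
  have : 0 <= rho ^+ 4 by rewrite exprn_ge0.
  by nra.
pose e := Num.sqrt D.
have e0 : 0 < e by rewrite sqrtr_gt0.
have e2 : e ^+ 2 = D by rewrite sqr_sqrtr // ltW.
have eq_ : e <= q.
  rewrite -(ler_pXn2r (n := 2)) ?nnegrE ?(ltW e0) ?(ltW q0) //.
  by rewrite e2 /D lerBlDr lerDl !mulr_ge0 // ltW.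
have ep : e <= 4 * p - q.
  have h : 0 < 4 * p - q by rewrite /p /q; nra.
  rewrite -(ler_pXn2r (n := 2)) ?nnegrE ?(ltW e0) ?(ltW h) // e2 -subr_ge0.
  have -> : (4 * p - q) ^+ 2 - D = 4 * p * (1 - rho ^+ 2).
    by rewrite /D /p /q /k; ring.
  by rewrite !mulr_ge0 ?(ltW p0) //; nra.
pose u := (- q + e) / (4 * p); pose v := (- q - e) / (4 * p).
have p4 : 0 < 4 * p by rewrite mulr_gt0.
have uI : -1 <= u <= 1 by rewrite ler_pdivlMr // ler_pdivrMr //; lra.
have vI : -1 <= v <= 1 by rewrite ler_pdivlMr // ler_pdivrMr //; lra.
(* Half the difference of the weights, solved from the two moments; [gm] then says that both weights
   are nonnegative. *)
pose g := (4 * p * m1 + m0 * q) / (2 * e).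
have m00 : 0 <= m0 by rewrite /m0; lra.
have gm : `|g| <= m0 / 2.
  have -> : g = (4 * p * m1 + m0 * q) / e / 2.
    by rewrite /g; field; rewrite gt_eqF.
  rewrite normrM (ger0_norm (_ : 0 <= 2^-1)) // ler_pM2r ?invr_gt0 //.
  rewrite normrM normfV (gtr0_norm e0) ler_pdivrMr //.
  rewrite -(ler_pXn2r (n := 2)) ?nnegrE ?mulr_ge0 ?(ltW e0) //.
  rewrite real_normK ?num_real // exprMn e2 -subr_ge0.
  (* The last factor is twice the Hankel determinant [m0 * m2 - m1 ^+ 2], with second moment
     [m2 = (k + m0) / 2]. *)
  have -> : m0 ^+ 2 * D - (4 * p * m1 + m0 * q) ^+ 2 =
            8 * p ^+ 2 * (m0 * (k + m0) - 2 * m1 ^+ 2).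
    by rewrite /D /m0 /m1 /p /q /k /sumpoly; ring.
  rewrite mulr_ge0 ?mulr_ge0 ?exprn_ge0 ?(ltW p0) //.
  have pow m n : (n <= m)%N -> 0 <= rho ^+ m <= rho ^+ n.
    by move=> nm; rewrite exprn_ge0 // ler_wiXn2l.
  have /andP[_ ?] := pow 4 2 isT; have /andP[_ ?] := pow 3 1 isT.
  have /andP[? ?] := pow 6 5 isT.
  rewrite /m0 /m1 /k /sumpoly; lra.
pose w := m0 / 2 + g; pose z := m0 / 2 - g.
have [w0 z0] : 0 <= w /\ 0 <= z.
  by move: gm; rewrite ler_norml /w /z => /andP[? ?]; lra.
have uv0 : w + z = m0 by rewrite /w /z; field.
have uv1 : w * u + z * v = m1.
  by rewrite /w /z /u /v /g; field; rewrite !gt_eqF.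
have rootP t : 4 * p * t = - q + e \/ 4 * p * t = - q - e ->
    t ^+ 2 = - (2 * q * t + k) / (4 * p).
  move=> tE; apply: (mulfI (lt0r_neq0 (mulr_gt0 p4 p4))).
  have -> : 4 * p * (4 * p) * t ^+ 2 = (4 * p * t) ^+ 2 by ring.
  have -> : 4 * p * (4 * p) * (- (2 * q * t + k) / (4 * p)) =
            - (2 * q * (4 * p * t) + k * (4 * p)).
    by field; rewrite gt_eqF.
  have D' : e ^+ 2 = q ^+ 2 - 4 * p * k by rewrite e2.
  by case: tE => ->; rewrite ?sqrrD ?sqrrB ?sqrrN D'; ring.
have u2 : u ^+ 2 = - (2 * q * u + k) / (4 * p).
  by apply: rootP; left; rewrite /u; field; rewrite gt_eqF.
have v2 : v ^+ 2 = - (2 * q * v + k) / (4 * p).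
  by apply: rootP; right; rewrite /v; field; rewrite gt_eqF.
have rec n : w * u ^+ n.+2 + z * v ^+ n.+2 =
   - (2 * q * (w * u ^+ n.+1 + z * v ^+ n.+1) + k * (w * u ^+ n + z * v ^+ n))
     / (4 * p).
  rewrite -addn2 !exprD u2 v2 !exprS; field; by rewrite gt_eqF.
(* [h2], [h3], [h4] amount to the Chebyshev moments of order 2, 3, 4 being [k], the coefficient of
   [a_2], [a_3], [a_4] in the difference. *)
have h2 : w * u ^+ 2 + z * v ^+ 2 = (k + m0) / 2.
  rewrite rec expr1 expr0 !mulr1 uv0 uv1.
  apply: (mulIf (lt0r_neq0 p4)); rewrite divfK ?gt_eqF //.
  by rewrite /m0 /m1 /k /p /q /sumpoly; field.
have h3 : w * u ^+ 3 + z * v ^+ 3 = (k + 3 * m1) / 4.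
  rewrite rec h2 expr1 uv1; apply: (mulIf (lt0r_neq0 p4)).
  rewrite divfK ?gt_eqF //.
  by rewrite /m0 /m1 /k /p /q /sumpoly; field.
have h4 : w * u ^+ 4 + z * v ^+ 4 = (5 * k + 3 * m0) / 8.
  rewrite rec h3 h2; apply: (mulIf (lt0r_neq0 p4)).
  rewrite divfK ?gt_eqF //.
  by rewrite /m0 /m1 /k /p /q /sumpoly; field.
have cu := mulr_ge0 w0 (chebyshev5_ge0 a_ge0 uI).
have cv := mulr_ge0 z0 (chebyshev5_ge0 a_ge0 vI).
rewrite cos_eval5 !mulr0 !cos0 !mulr1 -subr_ge0.
suff <- : w * (a 0 0 + a 0 1 * u + a 0 2 * (2 * u ^+ 2 - 1)
       + a 0 3 * (4 * u ^+ 3 - 3 * u) + a 0 4 * (8 * u ^+ 4 - 8 * u ^+ 2 + 1))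
  + z * (a 0 0 + a 0 1 * v + a 0 2 * (2 * v ^+ 2 - 1)
       + a 0 3 * (4 * v ^+ 3 - 3 * v) + a 0 4 * (8 * v ^+ 4 - 8 * v ^+ 2 + 1))
  = (3 * rho ^+ 2 - 1) * (a 0 0 + a 0 1 + a 0 2 + a 0 3 + a 0 4)
    - sumpoly rho * (rho * a 0 1 - a 0 0) by rewrite addr_ge0.
transitivity ((a 0 0 - a 0 2 + a 0 4) * (w + z)
  + (a 0 1 - 3 * a 0 3) * (w * u + z * v)
  + (2 * a 0 2 - 8 * a 0 4) * (w * u ^+ 2 + z * v ^+ 2)
  + 4 * a 0 3 * (w * u ^+ 3 + z * v ^+ 3)
  + 8 * a 0 4 * (w * u ^+ 4 + z * v ^+ 4)); first by ring.
by rewrite uv0 uv1 h2 h3 h4 /m0 /m1 /k; field.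
Qed.

End DualBound.

(** * Points of R^5 as nonnegative cosine polynomials, and the curve bounding [f(0)] *)

Section AutocorrelationPolynomials.
Variable R : realType.
Implicit Types (a b rho t : R) (x y : 'rV[R]_5).

Lemma cospoly_of_ge0 x phi : 0 <= cos_eval (cospoly_of x) phi.
Proof. by rewrite cospoly_ofE sqr_ge0. Qed.

Lemma cospoly_of5 x (f := cospoly_of x) :
  [/\ f 0 0 = x 0 0 ^+ 2 + x 0 1 ^+ 2 + x 0 2 ^+ 2 + x 0 3 ^+ 2 + x 0 4 ^+ 2,
      f 0 1 = 2 * (x 0 0 * x 0 1 + x 0 1 * x 0 2 + x 0 2 * x 0 3 + x 0 3 * x 0 4),
      f 0 2 = 2 * (x 0 0 * x 0 2 + x 0 1 * x 0 3 + x 0 2 * x 0 4),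
      f 0 3 = 2 * (x 0 0 * x 0 3 + x 0 1 * x 0 4)
    & f 0 4 = 2 * (x 0 0 * x 0 4)].
Proof.
rewrite /f; split; rewrite mxE !sum5 !(big_mkcond (fun l : 'I_5 => _ == _)) /=;
  by rewrite !sum5 /= ?(addr0, add0r, mul1r, expr2).
Qed.

(** Turns bounds on [f(0)] for nonnegative [f] with [a_0 = 1] into bounds on [F], hence on [p2]. *)
Lemma cospoly_of_feasible a x : feasible a x ->
  [/\ cospoly_of x 0 0 = 1, cospoly_of x 0 1 = a
    & cos_eval (cospoly_of x) 0 = F x + 1].
Proof.
case; rewrite sum5 => x1 xa; have [f0 f1 f2 f3 f4] := cospoly_of5 x.
split; [by rewrite f0 | by rewrite f1 | rewrite /F sum5].
by rewrite cos_eval5 !mulr0 !cos0 f0 f1 f2 f3 f4; ring.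
Qed.

Lemma p2_eq a x : feasible a x -> (forall y, feasible a y -> F x <= F y) ->
  p2 a = F x.
Proof.
move=> xa xmin; apply: xget_unique.
  by split; [exists x | move=> _ [y ya <-]; exact: xmin].
move=> m [[y ya <-] lb]; apply/eqP; rewrite eq_le xmin // andbT.
by apply: lb; exists x.
Qed.

(** The interval [[1/sqrt 3, 1]], described without a radical. *)
Definition in_range rho := (0 <= rho <= 1) && (1 <= 3 * rho ^+ 2).

Lemma normpoly_gt0 rho : 0 <= rho -> 0 < normpoly rho.
Proof.
by move=> r0; rewrite /normpoly; have := exprn_ge0 4 r0; have := exprn_ge0 2 r0; lra.
Qed.

Lemma in_range_bounds rho : in_range rho -> 4 / 7 <= rho <= 1.
Proof. by move=> /andP[/andP[r0 r1] rk]; rewrite r1 andbT; nra. Qed.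

Lemma coef_ge rho : in_range rho -> 5 / 3 <= coefpoly rho / normpoly rho.
Proof.
move=> /in_range_bounds /andP[r0 r1].
have r0' : 0 <= rho by lra.
rewrite ler_pdivlMr ?normpoly_gt0 // /coefpoly /normpoly.
have : rho ^+ 4 <= rho ^+ 2 by rewrite ler_wiXn2l.
have : 0 <= (1 - rho) * (rho - 1 / 3) by apply: mulr_ge0; lra.
by lra.
Qed.

Lemma coef_boundary rho : 0 <= rho -> 3 * rho ^+ 2 = 1 ->
  coefpoly rho / normpoly rho = 3 * rho /\ normpoly rho = 2 * sumpoly rho.
Proof.
move=> r0 rk.
have r2 : rho ^+ 2 = 1 / 3 by lra.
have r4 : rho ^+ 4 = 1 / 9 by rewrite (exprM _ 2 2) r2; field.
split; last by rewrite /normpoly /sumpoly r4 r2; field.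
apply: (mulIf (lt0r_neq0 (normpoly_gt0 r0))).
rewrite divfK ?gt_eqF ?normpoly_gt0 // /coefpoly /normpoly r4 r2.
have -> : 3 * rho * (3 * (1 / 9) + 12 * (1 / 3) + 16 * rho + 5) =
  28 * rho + 48 * rho ^+ 2 by field.
by rewrite r2; field.
Qed.

Variable f : 'rV[R]_5.
Hypothesis f_ge0 : forall phi, 0 <= cos_eval f phi.
Hypothesis f00 : f 0 0 = 1.

(* At [rho = 1 / sqrt 3] the bound [dual_bound] degenerates; use it slightly to
   the right instead. *)
Lemma value_boundary rho : 0 <= rho -> 3 * rho ^+ 2 = 1 -> f 0 1 = 3 * rho ->
  sumpoly rho <= 2 * cos_eval f 0.
Proof.
move=> r0 rk f1; rewrite leNgt; apply/negP => lt.
have rI : 4 / 7 <= rho <= 3 / 5 by apply/andP; split; nra.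
have v0 := f_ge0 0; set v := cos_eval f 0 in lt v0 *.
(* A shift proportional to the supposed gap. After division by [3 * d] the bound at [rho + d] is
   [rho * S(rho + d) <= (2 * rho + d) * v], which forces [100 * d] below a much smaller multiple of
   [d], since [v < 6]. *)
pose d := rho * (sumpoly rho - 2 * v) / 100.
have d0 : 0 < d by rewrite /d; apply: divr_gt0 => //; nra.
have S12 : sumpoly rho <= 12 by rewrite /sumpoly; nra.
have d1 : d <= 12 / 100 by rewrite /d; nra.
have td : 0 <= rho + d <= 1 by apply/andP; split; lra.
have tk : 1 <= 3 * (rho + d) ^+ 2 by nra.
have := dual_bound f_ge0 td tk; rewrite f1 f00 -/v.
have -> : (rho + d) * (3 * rho) - 1 = 3 * rho * d.
  by rewrite -[X in _ - X]rk; ring.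
have -> : 3 * (rho + d) ^+ 2 - 1 = 3 * (2 * rho + d) * d.
  by rewrite -[X in _ - X]rk; ring.
rewrite mulrA [leRHS]mulrAC ler_pM2r // => le.
have dE : 100 * d = rho * (sumpoly rho - 2 * v) by rewrite /d; field.
have : sumpoly (rho + d) = sumpoly rho + (8 - 2 * rho) * d - d ^+ 2.
  by rewrite /sumpoly; ring.
move=> SE; rewrite SE in le.
have : rho * (sumpoly rho - 2 * v) <= d * (v - rho * (8 - 2 * rho) + rho * d).
  by lra.
rewrite -dE mulrC ler_pM2l //; nra.
Qed.

(** For [a_1 = C/N], [rho * a_1 - 1] equals [(3 * rho ^+ 2 - 1) * S / N], so the factor
    [3 * rho ^+ 2 - 1] cancels from [dual_bound]; where it vanishes, [value_boundary] takes over. *)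
Lemma value_ge_curve rho : in_range rho ->
  coefpoly rho / normpoly rho = f 0 1 ->
  sumpoly rho ^+ 2 / normpoly rho <= cos_eval f 0.
Proof.
case/andP => /andP[rho0 rho1] rk2 E; have nrho := normpoly_gt0 rho0.
have S0 : 0 < sumpoly rho by rewrite /sumpoly; nra.
move: rk2; rewrite le_eqVlt => /predU1P[rk2|rk2].
  have [cr' nr'] := coef_boundary rho0 (esym rk2).
  have := value_boundary rho0 (esym rk2).
  rewrite -E cr' => /(_ erefl) h; rewrite nr' ler_pdivrMr ?mulr_gt0 ?S0 //.
  by rewrite mulrA [_ * 2]mulrC expr2 ler_pM2r ?S0.
have k0 : 0 < 3 * rho ^+ 2 - 1 by lra.
have := dual_bound f_ge0 (introT andP (conj rho0 rho1)) (ltW rk2).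
rewrite f00 -E.
have -> : rho * (coefpoly rho / normpoly rho) - 1 =
    (3 * rho ^+ 2 - 1) * sumpoly rho / normpoly rho.
  apply: (mulIf (lt0r_neq0 nrho)); rewrite mulrBl -!mulrA mulVf ?gt_eqF //.
  by rewrite mul1r !mulr1 /coefpoly /normpoly /sumpoly; ring.
by rewrite mulrCA -!mulrA ler_pM2l // mulrA -expr2.
Qed.

Lemma sqrt3_third (r := Num.sqrt 3 / 3 : R) :
  [/\ 0 <= r, r <= 1, 3 * r ^+ 2 = 1 & 3 * r = Num.sqrt 3].
Proof.
have s3 : Num.sqrt 3 ^+ 2 = 3 :> R by rewrite sqr_sqrtr.
have s0 : 0 <= Num.sqrt 3 :> R by exact: sqrtr_ge0.
have r2 : 3 * r ^+ 2 = 1 by rewrite /r expr_div_n s3; field.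
have r0 : 0 <= r by rewrite /r divr_ge0.
by split => //; [nra | rewrite /r; field].
Qed.

(** Fejer's bound: at [rho = 1/sqrt 3] the right side of [dual_bound] vanishes. *)
Lemma coef1_le_sqrt3 : f 0 1 <= Num.sqrt 3.
Proof.
have [r0 r1 rk <-] := sqrt3_third; set r := Num.sqrt _ / 3 in r0 r1 rk *.
have S0 : 0 < sumpoly r by rewrite /sumpoly; nra.
have := @dual_bound _ f r f_ge0.
rewrite r0 r1 rk subrr mul0r pmulr_rle0 // => /(_ isT (lexx _)).
by rewrite f00 subr_le0; nra.
Qed.

(** Intermediate value theorem for the polynomial [a * N - C]; the bounds on [a] give its signs at
    the endpoints. *)
Lemma coef_surj a : 5 / 3 <= a <= Num.sqrt 3 ->
  exists2 rho, in_range rho & coefpoly rho / normpoly rho = a.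
Proof.
have [r0 r1 rk <-] := sqrt3_third; set r := Num.sqrt _ / 3 in r0 r1 rk *.
move=> /andP[a1 ar].
have [cr _] := coef_boundary r0 rk; have nr := normpoly_gt0 r0.
pose P : {poly R} := (a * 3) *: 'X^4 + (a * 12 - 24) *: 'X^2
  + (a * 16 - 28) *: 'X + (a * 5 - 8)%:P.
have PE t : P.[t] = a * normpoly t - coefpoly t.
  rewrite /P !hornerD !hornerZ !hornerXn hornerX hornerC.
  by rewrite /normpoly /coefpoly; ring.
have [] := @poly_ivt R P r 1 r1.
  rewrite !PE; apply/andP; split; last by rewrite /normpoly /coefpoly; lra.
  by rewrite subr_le0 -ler_pdivlMr // cr.
move=> rho /andP[rr rho1]; rewrite /root PE subr_eq0 => /eqP rhoE.
have rho0 : 0 <= rho by lra.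
exists rho; last by rewrite -rhoE mulfK // gt_eqF // normpoly_gt0.
by rewrite /in_range rho0 rho1 -rk; nra.
Qed.

End AutocorrelationPolynomials.

(** * From a ratio with a radical to a polynomial inequality in [rho] *)

Section Minimization.
Variable R : realType.
Implicit Types (a v rho t d : R).

(** The value of [vn] at the extremal polynomial with parameter [rho]; see [vn_extremal]. *)
Definition ratio rho : R :=
  (sumpoly rho ^+ 2 / normpoly rho - 1)
  / (Num.sqrt (coefpoly rho / normpoly rho) - 1) ^+ 2.

(* With [s = sqrt (b / v)], the inequality says [s >= sqrt a - 1]; squaring
   twice removes both radicals. *)
Lemma le_sqrt_sub1 v a b : 0 < v -> 0 <= b -> 1 <= a ->
  (v * (a - 1) - b) ^+ 2 <= 4 * v * b -> v * (Num.sqrt a - 1) ^+ 2 <= b.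
Proof.
move=> v0 b0 a1 h; rewrite leNgt; apply/negP => lt.
have a2 : a = Num.sqrt a ^+ 2 by rewrite sqr_sqrtr //; lra.
have s1 : 1 <= Num.sqrt a by rewrite -sqrtr1 ler_wsqrtr.
set s := Num.sqrt a in a2 s1 lt; rewrite a2 in h.
have D0 : 0 < v * (s - 1) ^+ 2 - b by lra.
have D1 : 0 <= v * (s - 1) by apply: mulr_ge0; lra.
have : 4 * v * (v * (s - 1) ^+ 2) <= (v * (s ^+ 2 - 1) - b) ^+ 2.
  have -> : 4 * v * (v * (s - 1) ^+ 2) = (2 * (v * (s - 1))) ^+ 2 by ring.
  have -> : v * (s ^+ 2 - 1) - b = (v * (s - 1) ^+ 2 - b) + 2 * (v * (s - 1)).
    by ring.
  by rewrite ler_pXn2r // ?nnegrE; lra.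
have : 4 * v * b < 4 * v * (v * (s - 1) ^+ 2) by rewrite ltr_pM2l //; lra.
by lra.
Qed.

(** The reverse comparison; [b <= v * (a - 1)] makes the squared quantity nonnegative, so that
    squares can be compared. *)
Lemma ge_sqrt_sub1 v a b : 0 < v -> 0 <= b -> 1 <= a -> b <= v * (a - 1) ->
  4 * v * b <= (v * (a - 1) - b) ^+ 2 -> b <= v * (Num.sqrt a - 1) ^+ 2.
Proof.
move=> v0 b0 a1 ba h; rewrite leNgt; apply/negP => lt.
have a2 : a = Num.sqrt a ^+ 2 by rewrite sqr_sqrtr //; lra.
have s1 : 1 <= Num.sqrt a by rewrite -sqrtr1 ler_wsqrtr.
set s := Num.sqrt a in a2 s1 lt; rewrite a2 in h ba.
have D0 : 0 < b - v * (s - 1) ^+ 2 by lra.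
have D1 : 0 <= v * (s - 1) by apply: mulr_ge0; lra.
have : (v * (s ^+ 2 - 1) - b) ^+ 2 <= 4 * v * (v * (s - 1) ^+ 2).
  have -> : 4 * v * (v * (s - 1) ^+ 2) = (2 * (v * (s - 1))) ^+ 2 by ring.
  have E : v * (s ^+ 2 - 1) - b = 2 * (v * (s - 1)) - (b - v * (s - 1) ^+ 2).
    by ring.
  by rewrite ler_pXn2r // ?nnegrE; lra.
have : 4 * v * (v * (s - 1) ^+ 2) < 4 * v * b by rewrite ltr_pM2l //; lra.
by lra.
Qed.

(* The difference of the two sides of the hypothesis of [le_sqrt_sub1], times
   [normpoly rho ^+ 2]. *)
Definition crit v rho : R :=
  4 * v * (sumpoly rho ^+ 2 - normpoly rho) * normpoly rho
  - (v * (coefpoly rho - normpoly rho) - (sumpoly rho ^+ 2 - normpoly rho)) ^+ 2.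

Lemma value_ge0 rho : in_range rho -> 0 <= sumpoly rho ^+ 2 / normpoly rho - 1.
Proof.
move=> /in_range_bounds /andP[r0 r1]; have r0' : 0 <= rho by lra.
rewrite subr_ge0 ler_pdivlMr ?normpoly_gt0 // mul1r /sumpoly /normpoly.
have : rho ^+ 4 <= rho ^+ 2 by rewrite ler_wiXn2l.
have : rho ^+ 3 <= rho ^+ 2 by rewrite ler_wiXn2l.
have : 0 <= rho ^+ 4 by rewrite exprn_ge0.
by nra.
Qed.

Lemma sqrt_coef_gt1 rho : in_range rho ->
  0 < (Num.sqrt (coefpoly rho / normpoly rho) - 1) ^+ 2.
Proof.
move=> /coef_ge h; rewrite exprn_gt0 // subr_gt0 -[ltLHS]sqrtr1 ltr_sqrt; lra.
Qed.

Lemma ratio_ge v rho : in_range rho -> 0 < v -> 0 <= crit v rho -> v <= ratio rho.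
Proof.
move=> rI v0 h; rewrite /ratio ler_pdivlMr ?sqrt_coef_gt1 //.
have n0 : 0 < normpoly rho by apply: normpoly_gt0; case/andP: rI => /andP[].
apply: le_sqrt_sub1 => //; first exact: value_ge0.
  by have := coef_ge rI; lra.
rewrite -subr_ge0; move: h; rewrite -(pmulr_rge0 _ (exprn_gt0 2 n0)).
rewrite -(pmulr_rge0 _ (exprn_gt0 2 n0)).
have n1 := lt0r_neq0 n0.
suff -> : crit v rho = normpoly rho ^+ 2 *
  (4 * v * (sumpoly rho ^+ 2 / normpoly rho - 1)
   - (v * (coefpoly rho / normpoly rho - 1)
      - (sumpoly rho ^+ 2 / normpoly rho - 1)) ^+ 2).
  by rewrite pmulr_rge0 // exprn_gt0.
by rewrite /crit; field.
Qed.

(* [rho0] approximates the minimizer of [ratio], [v0] exceeds the minimum by less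
   than [10 ^- 15], and [v1] is the lower end of the interval of numbers rounding
   to 34.8992259. *)
Definition rho0 : R := 84499024%:R / 10 ^+ 8.
Definition v0 : R := 348992258876727%:R / 10 ^+ 13.
Definition v1 : R := 3489922585%:R / 10 ^+ 8.

(** Homogenization: [k] and [m] clear the decimal denominators of [rho0] and of [v0] or [v1]. *)
Lemma crit_scaled v rho k m (r := k * rho) (w := m * v) :
  k ^+ 8 * m ^+ 2 * crit v rho =
  4 * w * m * ((5 * k ^+ 2 + 8 * k * r - r ^+ 2) ^+ 2
    - (3 * r ^+ 4 + 12 * k ^+ 2 * r ^+ 2 + 16 * k ^+ 3 * r + 5 * k ^+ 4))
    * (3 * r ^+ 4 + 12 * k ^+ 2 * r ^+ 2 + 16 * k ^+ 3 * r + 5 * k ^+ 4)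
  - (w * (24 * k ^+ 2 * r ^+ 2 + 28 * k ^+ 3 * r + 8 * k ^+ 4
       - (3 * r ^+ 4 + 12 * k ^+ 2 * r ^+ 2 + 16 * k ^+ 3 * r + 5 * k ^+ 4))
     - m * ((5 * k ^+ 2 + 8 * k * r - r ^+ 2) ^+ 2
       - (3 * r ^+ 4 + 12 * k ^+ 2 * r ^+ 2 + 16 * k ^+ 3 * r + 5 * k ^+ 4))) ^+ 2.
Proof. by rewrite /r /w /crit /sumpoly /normpoly /coefpoly; ring. Qed.

(* Up to small terms of degree at most 1, [crit v0 (rho0 + d)] is [d ^+ 2] times
   [300387 + 770297 d + 643997 d ^+ 2 + 83775 d ^+ 3 - 156421 d ^+ 4
    - 80372 d ^+ 5 - 11384 d ^+ 6], whose quadratic part is minimal near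
   [d = - 3 / 5].  The scaling [D = 10 ^+ 8 * d] makes all coefficients integral,
   without which the arithmetic is too slow. *)
Lemma crit_taylor rho (d := rho - rho0) : in_range rho ->
  3 * 10 ^+ 4 * d ^+ 2 - 3 / 10 ^+ 11 <= crit v0 rho /\ 0 <= crit v1 rho.
Proof.
move=> /in_range_bounds /andP[r0 r1].
have K8 : 0 < 10 ^+ 8 :> R by rewrite exprn_gt0.
pose D := 10 ^+ 8 * d.
have rE : 10 ^+ 8 * rho = 84499024%:R + D by rewrite /D /d /rho0; lra.
have DE : d = D / 10 ^+ 8 by rewrite /D mulrAC divff ?mul1r // gt_eqF.
have DI : - (28 * 10 ^+ 6) <= D <= 16 * 10 ^+ 6.
  by apply/andP; split; lra.
have w0 : 10 ^+ 13 * v0 = 348992258876727%:R by rewrite /v0; lra.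
have w1 : 10 ^+ 8 * v1 = 3489922585%:R by rewrite /v1; lra.
move: (crit_scaled v0 rho (10 ^+ 8) (10 ^+ 13)).
move: (crit_scaled v1 rho (10 ^+ 8) (10 ^+ 8)).
rewrite rE w0 w1 DE.
move: (crit v0 rho) (crit v1 rho) => c0 c1.
clear -DI; clearbody D; clear -DI.
have d2 : 0 <= D ^+ 2 by exact: sqr_ge0.
have dd n : - (D ^+ 2 * (28 * 10 ^+ 6) ^+ n) <= D ^+ n.+2 <=
    D ^+ 2 * (28 * 10 ^+ 6) ^+ n.
  rewrite -ler_norml -addn2 exprD normrM [leLHS]mulrC.
  rewrite (ger0_norm d2) ler_wpM2l // normrX lerXn2r ?nnegrE ?mulr_ge0 //.
  by rewrite ler_norml; lra.
have d3 := dd 1%N; have d4 := dd 2%N; have d5 := dd 3%N; have d6 := dd 4.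
have d7 := dd 5%N; have d8 := dd 6%N; clear dd DI.
(* This square vanishes at [d = - 3 / 5]. The squares [l0] and [l1] are there to absorb the linear
   terms in [D]. *)
have dp : 0 <= D ^+ 2 * (D + 6 * 10 ^+ 7) ^+ 2 by rewrite mulr_ge0 ?sqr_ge0.
have l0 : 0 <= (5 * D - 8) ^+ 2 by exact: sqr_ge0.
have l1 : 0 <= (D + 1) ^+ 2 by exact: sqr_ge0.
move=> e1 e0; cbv zeta in e1, e0.
by split; lra.
Qed.

End Minimization.

(** * Existence and location of the minimizer, and the smaller values of [a_1] *)

Section Minimizer.
Import numFieldNormedType.Exports.
Variable R : realType.
Implicit Types (a v rho t : R).

Lemma ratio_continuous rho : in_range rho -> {for rho, continuous (@ratio R)}.
Proof.
move=> rI; have r0 : 0 <= rho by case/andP: rI => /andP[].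
have cN : {for rho, continuous (@normpoly R)}.
  rewrite /normpoly; do ?[exact: cst_continuous | exact: cvg_id
    | exact: exprn_continuous | apply: continuousM | apply: continuousD].
have cV : {for rho, continuous (fun t => (normpoly t : R)^-1)}.
  by apply: continuousV => //; rewrite gt_eqF // normpoly_gt0.
have cQ : {for rho, continuous (fun t : R => Num.sqrt (coefpoly t / normpoly t))}.
  apply: (@continuous_comp _ _ _ (fun t : R => coefpoly t / normpoly t) Num.sqrt);
    last exact: sqrt_continuous.
  apply: continuousM => //.
  rewrite /coefpoly; do ?[exact: cst_continuous | exact: cvg_id
    | exact: exprn_continuous | apply: continuousM | apply: continuousD].
have cX (g : R -> R) : {for rho, continuous g} ->
    {for rho, continuous (fun t => g t ^+ 2)}.
  move=> cg; apply: (@continuous_comp _ _ _ g (fun t => t ^+ 2)) => //.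
  exact: exprn_continuous.
rewrite /ratio; apply: continuousM.
  apply: continuousB; last exact: cst_continuous.
  apply: continuousM => //; apply: cX.
  rewrite /sumpoly; do ?[exact: cst_continuous | exact: cvg_id
    | exact: exprn_continuous | apply: continuousM | apply: continuousB
    | apply: continuousD].
apply: continuousV; first by rewrite gt_eqF // sqrt_coef_gt1.
by apply: cX; apply: continuousB => //; exact: cst_continuous.
Qed.

Lemma near_rho0_in_range rho : `|rho - rho0 R| <= 5 / 10 ^+ 8 -> in_range rho.
Proof.
rewrite ler_norml => /andP[l u]; rewrite /rho0 in l u.
by apply/andP; split; [apply/andP; split; lra | nra].
Qed.

Lemma ratio_le v rho : in_range rho -> 0 < v ->
  sumpoly rho ^+ 2 - normpoly rho <= v * (coefpoly rho - normpoly rho) ->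
  crit v rho <= 0 -> ratio rho <= v.
Proof.
move=> rI vgt0 hv hc; rewrite /ratio ler_pdivrMr ?sqrt_coef_gt1 //.
have n0 : 0 < normpoly rho by apply: normpoly_gt0; case/andP: rI => /andP[].
have n1 := lt0r_neq0 n0.
apply: ge_sqrt_sub1 => //; first exact: value_ge0.
- by have := coef_ge rI; lra.
- rewrite -(ler_pM2r n0) mulrBl divfK // mul1r -mulrA mulrBl.
  by rewrite divfK // mul1r.
rewrite -subr_le0 -(pmulr_rle0 _ (exprn_gt0 2 n0)).
suff <- : crit v rho = normpoly rho ^+ 2 *
  (4 * v * (sumpoly rho ^+ 2 / normpoly rho - 1)
   - (v * (coefpoly rho / normpoly rho - 1)
      - (sumpoly rho ^+ 2 / normpoly rho - 1)) ^+ 2) by [].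
by rewrite /crit; field.
Qed.

Lemma v0_gt0 : 0 < v0 R. Proof. by rewrite /v0; lra. Qed.
Lemma v1_gt0 : 0 < v1 R. Proof. by rewrite /v1; lra. Qed.

Lemma ratio_rho0_le : ratio (rho0 R) <= v0 R.
Proof.
apply: ratio_le.
- by apply: near_rho0_in_range; rewrite subrr normr0 divr_ge0.
- exact: v0_gt0.
- rewrite /v0 /sumpoly /normpoly /coefpoly /rho0; lra.
- rewrite /crit /v0 /sumpoly /normpoly /coefpoly /rho0; lra.
Qed.

(** The extreme value theorem gives a minimizer near [rho0]. Farther away [crit v0] is nonnegative,
    because [3 * 10 ^+ 4 * (5 / 10 ^+ 8) ^+ 2] exceeds [3 / 10 ^+ 11], so [ratio] is at least [v0]
    there. *)
Lemma ratio_min : exists rho, [/\ in_range rho, `|rho - rho0 R| <= 5 / 10 ^+ 8,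
  v1 R <= ratio rho <= v0 R
  & forall t, in_range t -> ratio rho <= ratio t].
Proof.
have e0 : 0 <= 5 / 10 ^+ 8 :> R by rewrite divr_ge0.
have le : rho0 R - 5 / 10 ^+ 8 <= rho0 R + 5 / 10 ^+ 8 by lra.
have [|rho rI rmin] := @EVT_min R (@ratio R) _ _ le.
  apply: continuous_in_subspaceT => t.
  rewrite inE /= in_itv /= => tI; apply: ratio_continuous.
  by apply: near_rho0_in_range; rewrite ler_distl.
have rn : `|rho - rho0 R| <= 5 / 10 ^+ 8 by rewrite ler_distl; move: rI; rewrite in_itv.
have rR := near_rho0_in_range rn.
have rv : ratio rho <= v0 R.
  apply: le_trans ratio_rho0_le; apply: rmin.
  by rewrite in_itv /= lerBlDr lerDl e0.
exists rho; split => //.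
  rewrite rv andbT; apply: ratio_ge; [exact: rR | exact: v1_gt0 |].
  by have [_ ->] := crit_taylor rR.
move=> t tR; have [tn|tn] := leP `|t - rho0 R| (5 / 10 ^+ 8).
  by apply: rmin; rewrite in_itv /= -ler_distl.
apply: (le_trans rv); apply: ratio_ge; [exact: tR | exact: v0_gt0 |].
have [+ _] := crit_taylor tR; apply: le_trans.
have : (5 / 10 ^+ 8) ^+ 2 <= `|t - rho0 R| ^+ 2.
  by rewrite ler_pXn2r ?nnegrE // ltW.
rewrite real_normK ?num_real //.
by move: (t - rho0 R) => d; clear; lra.
Qed.

Lemma v0_le : v0 R <= 349 / 10.
Proof. by rewrite /v0; lra. Qed.

Lemma line_ge_v0 a : 3 / 2 <= a <= 5 / 3 ->
  v0 R * (Num.sqrt a - 1) ^+ 2 <= 6 * a - 7.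
Proof.
move=> /andP[a1 a2]; apply: (@le_trans _ _ (349 / 10 * (Num.sqrt a - 1) ^+ 2)).
  by rewrite ler_wpM2r ?sqr_ge0 ?v0_le.
have s2 : a = Num.sqrt a ^+ 2 by rewrite sqr_sqrtr //; lra.
have s0 := sqrtr_ge0 a; set s := Num.sqrt a in s0 s2 *; rewrite s2 in a1 a2 *.
(* Rational bounds just outside [sqrt (3/2)] and [sqrt (5/3)]; between them a convex quadratic in
   [s] is nonpositive. *)
have sl : 60 / 49 <= s by nra.
have su : s <= 31 / 24 by nra.
by nra.
Qed.

Lemma chord_ge_v0 a : 1 <= a <= 3 / 2 ->
  v0 R * (Num.sqrt a - 1) ^+ 2 <= 2 * a - 1.
Proof.
move=> /andP[a1 a2]; apply: (@le_trans _ _ (349 / 10 * (Num.sqrt a - 1) ^+ 2)).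
  by rewrite ler_wpM2r ?sqr_ge0 ?v0_le.
have s2 : a = Num.sqrt a ^+ 2 by rewrite sqr_sqrtr //; lra.
have s0 := sqrtr_ge0 a; set s := Num.sqrt a in s0 s2 *; rewrite s2 in a1 a2 *.
have sl : 1 <= s by nra.
have su : s <= 49 / 40 by nra.
by nra.
Qed.

End Minimizer.

(** * Lower bounds for nonnegative polynomials with [a_0 = 1] *)

Section LowerBound.
Variables (R : realType) (V : R).
Hypothesis V_le : V <= v0 R.
Hypothesis V_min : forall t, in_range t -> V <= ratio t.
Variable f : 'rV[R]_5.
Hypothesis f_ge0 : forall phi, 0 <= cos_eval f phi.
Hypothesis f00 : f 0 0 = 1.

Lemma value_ge_line : 6 * f 0 1 - 6 <= cos_eval f 0.
Proof.
have := @dual_bound _ f 1 f_ge0.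
rewrite ler01 lexx expr1n f00 mul1r /sumpoly expr1n => h.
have /h : true && true by [].
have : 1 <= 3 * 1 :> R by lra.
by move=> /[swap] /[apply]; lra.
Qed.

(** Up to 5/3 the line [6 a - 6] decides, beyond it the curve. This form serves feasible points,
    whose coefficients may have either sign. *)
Lemma value_ge_V : 3 / 2 <= f 0 1 ->
  V * (Num.sqrt (f 0 1) - 1) ^+ 2 <= cos_eval f 0 - 1.
Proof.
move=> f1; have [h|/ltW h] := leP (f 0 1) (5 / 3).
  apply: (@le_trans _ _ (v0 R * (Num.sqrt (f 0 1) - 1) ^+ 2)).
    by rewrite ler_wpM2r ?sqr_ge0.
  have := @line_ge_v0 R (f 0 1); rewrite f1 h => /(_ isT) /le_trans; apply.
  by have := value_ge_line; lra.
have [|rho rI rE] := @coef_surj R (f 0 1); first by rewrite h coef1_le_sqrt3.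
have rv := value_ge_curve f_ge0 f00 rI rE.
rewrite -rE -ler_pdivlMr ?sqrt_coef_gt1 //.
apply: (le_trans (V_min rI)); rewrite /ratio ler_pM2r ?invr_gt0 ?sqrt_coef_gt1 //.
by rewrite lerB.
Qed.

Hypothesis f_coef_ge0 : forall k, 0 <= f 0 k.

Lemma value_ge_V_coef : 1 <= f 0 1 ->
  V * (Num.sqrt (f 0 1) - 1) ^+ 2 <= cos_eval f 0 - 1.
Proof.
move=> f1; have [h|/ltW h] := leP (f 0 1) (3 / 2); last exact: value_ge_V.
apply: (@le_trans _ _ (v0 R * (Num.sqrt (f 0 1) - 1) ^+ 2)).
  by rewrite ler_wpM2r ?sqr_ge0.
have := @chord_ge_v0 R (f 0 1); rewrite f1 h => /(_ isT) /le_trans; apply.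
(* The point [phi = pi]: [f(0) - f(pi) = 2 * (a_1 + a_3)]. *)
have : -1 <= (-1 : R) <= 1 by rewrite lexx; lra.
move=> /(chebyshev5_ge0 f_ge0); have := f_coef_ge0 3.
by rewrite cos_eval5 !mulr0 !cos0 f00; lra.
Qed.

End LowerBound.

(** * Extremal points, their decimals, and the reduction of C_4 to [a_0 = 1] *)

Section Extremal.
Variable R : realType.
Implicit Types (a rho : R) (x y : 'rV[R]_5) (k : 'I_5).

(* The eigenvector of the quadratic form behind [dual_bound], as a rational
   function of [rho]. *)
Definition kernelpoly rho (k : nat) : R :=
  nth 0 [:: 1 + rho - rho ^+ 2; 1 + 2 * rho; (1 + rho) ^+ 2;
            1 + 2 * rho; 1 + rho - rho ^+ 2] k.

Definition extremal rho : 'rV[R]_5 :=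
  \row_k (kernelpoly rho k / Num.sqrt (normpoly rho)).

Lemma extremal_mul rho (j k : 'I_5) : 0 <= rho ->
  extremal rho 0 j * extremal rho 0 k =
  kernelpoly rho j * kernelpoly rho k / normpoly rho.
Proof.
move=> r0; rewrite !mxE mulrACA -invfM -expr2 sqr_sqrtr //.
by rewrite ltW // normpoly_gt0.
Qed.

Lemma extremal_feasible rho : 0 <= rho ->
  feasible (coefpoly rho / normpoly rho) (extremal rho).
Proof.
move=> r0; have n1 := lt0r_neq0 (normpoly_gt0 r0).
split; rewrite ?sum5 ?expr2 !extremal_mul // /kernelpoly /=.
  apply: (mulIf n1); rewrite !mulrDl !divfK // mul1r /normpoly.
  by ring.
by apply: (mulIf n1); rewrite divfK // /coefpoly; field.
Qed.

Lemma F_extremal rho : 0 <= rho ->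
  F (extremal rho) = sumpoly rho ^+ 2 / normpoly rho - 1.
Proof.
move=> r0; rewrite /F sum5 !mxE -!mulrDl expr_div_n sqr_sqrtr; last first.
  by rewrite ltW // normpoly_gt0.
by rewrite /kernelpoly /sumpoly /=; congr (_ / _ - 1); ring.
Qed.

(** Guarantees that [p2 a] is a true minimum and not the default value 0. *)
Lemma p2_attained a : 3 / 2 <= a <= Num.sqrt 3 ->
  exists2 x, feasible a x & F x = p2 a.
Proof.
move=> /andP[a1 a3]; have [a2|/ltW a2] := leP a (5 / 3); last first.
  have [|rho rI <-] := @coef_surj R a; first by rewrite a2.
  have r0 : 0 <= rho by case/andP: rI => /andP[].
  have xf := extremal_feasible r0.
  exists (extremal rho) => //; apply/esym/p2_eq => // y yf.
  have [f0 f1 fF] := cospoly_of_feasible yf.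
  rewrite F_extremal // lerBlDr -fF.
  by apply: value_ge_curve => //; exact: cospoly_of_ge0.
(* At [rho = 1] the kernel of the quadratic form becomes two-dimensional, and
   its unit vectors attain the bound [6 a - 7] for the remaining [a]. *)
pose c := Num.sqrt (3 * (a - 1) / 2); pose s := Num.sqrt (1 - 3 * (a - 1) / 2).
have c2 : c ^+ 2 = 3 * (a - 1) / 2 by rewrite sqr_sqrtr //; lra.
have s2 : s ^+ 2 = 1 - 3 * (a - 1) / 2 by rewrite sqr_sqrtr //; lra.
pose x : 'rV[R]_5 := \row_k nth 0 [:: c / 6 + s / 2; c / 2 + s / 2; 2 * c / 3;
  c / 2 - s / 2; c / 6 - s / 2] k.
have xf : feasible a x.
  split; rewrite ?sum5 !mxE /=; lra.
have xF : F x = 6 * a - 7 by rewrite /F sum5 !mxE /=; lra.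
exists x => //; apply/esym/p2_eq => // y yf; rewrite xF.
have [f0 f1 fF] := cospoly_of_feasible yf.
have := value_ge_line (@cospoly_of_ge0 R y) f0; rewrite fF f1; lra.
Qed.

Lemma extremal_coefs rho (f := cospoly_of (extremal rho)) (p := kernelpoly rho 0)
    (q := kernelpoly rho 1) (s := kernelpoly rho 2) (n := normpoly rho) :
  0 <= rho ->
  [/\ f 0 0 = 1, f 0 1 = coefpoly rho / n, f 0 2 = 2 * (2 * p * s + q ^+ 2) / n,
      f 0 3 = 4 * p * q / n & f 0 4 = 2 * p ^+ 2 / n].
Proof.
move=> r0; rewrite /f.
have [-> -> _] := cospoly_of_feasible (extremal_feasible r0).
have [_ _ -> -> ->] := cospoly_of5 (extremal rho).
rewrite !extremal_mul // /p /q /s /n /kernelpoly /=.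
by split => //; field; exact: lt0r_neq0 (normpoly_gt0 r0).
Qed.

Lemma extremal_in_Cn rho : in_range rho -> Cn R 4 (cospoly_of (extremal rho)).
Proof.
move=> rI; have r0 : 0 <= rho by case/andP: rI => /andP[].
have r1 : rho <= 1 by case/andP: rI => /andP[].
have n0 := ltW (normpoly_gt0 r0).
have [f0 f1 f2 f3 f4] := extremal_coefs r0.
have p0 : 0 <= kernelpoly rho 0 by rewrite /kernelpoly /=; nra.
have q0 : 0 <= kernelpoly rho 1 by rewrite /kernelpoly /=; nra.
have s0 : 0 <= kernelpoly rho 2 by rewrite /kernelpoly /= sqr_ge0.
have c1 := coef_ge rI.
split; last exact: cospoly_of_ge0.
  have E k (j : 'I_5) : j = k :> nat ->
    cospoly_of (extremal rho) 0 k = cospoly_of (extremal rho) 0 j.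
    by move=> jk; congr (_ 0 _); apply/val_inj.
  case=> [[|[|[|[|[|//]]]]]] i.
  - by rewrite (E _ 0) // f0.
  - by rewrite (E _ 1) // f1; lra.
  - rewrite (E _ 2) // f2; apply: divr_ge0 => //; apply: mulr_ge0 => //.
    by apply: addr_ge0; [do 2!apply: mulr_ge0 => // | exact: sqr_ge0].
  - by rewrite (E _ 3) // f3; apply: divr_ge0 => //; do 2!apply: mulr_ge0 => //.
  - by rewrite (E _ 4) // f4; apply: divr_ge0 => //; apply: mulr_ge0 => //; exact: sqr_ge0.
rewrite /Defs.coef1 (_ : inord 1 = 1); last by apply/val_inj; rewrite /= inordK.
by rewrite f0 f1; split; lra.
Qed.

Lemma vn_extremal rho : 0 <= rho -> vn (cospoly_of (extremal rho)) = ratio rho.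
Proof.
move=> r0; have [f0 f1 fF] := cospoly_of_feasible (extremal_feasible r0).
rewrite /vn /Defs.coef1 (_ : inord 1 = 1); last by apply/val_inj; rewrite /= inordK.
by rewrite fF f0 f1 sqrtr1 addrK F_extremal.
Qed.

(** Squaring removes the radical, leaving inequalities polynomial in [rho]. *)
Lemma div_sqrt_near (u n d e : R) : 0 < u -> 0 < n -> 0 <= e <= d ->
  (d - e) ^+ 2 * n < u ^+ 2 < (d + e) ^+ 2 * n -> `|u / Num.sqrt n - d| < e.
Proof.
move=> u0 n0 /andP[e0 ed] /andP[l h].
have s0 : 0 < Num.sqrt n by rewrite sqrtr_gt0.
have de : 0 <= d - e by rewrite subr_ge0.
have d0 : 0 <= d + e by rewrite addr_ge0 // (le_trans e0).
have s2 : n = Num.sqrt n ^+ 2 by rewrite sqr_sqrtr // ltW.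
rewrite ltr_distl ltr_pdivlMr // ltr_pdivrMr //; apply/andP; split.
  rewrite -(ltr_pXn2r (n := 2)) ?nnegrE ?mulr_ge0 ?(ltW s0) ?(ltW u0) //.
  by rewrite exprMn -s2.
rewrite -(ltr_pXn2r (n := 2)) ?nnegrE ?mulr_ge0 ?(ltW s0) ?(ltW u0) //.
by rewrite exprMn -s2.
Qed.

Lemma div_near (u n d e : R) : 0 < n -> (d - e) * n < u < (d + e) * n ->
  `|u / n - d| < e.
Proof. by move=> n0; rewrite ltr_distl ltr_pdivlMr // ltr_pdivrMr. Qed.

(** With the powers of [d] bounded separately, the decimal estimates become linear in them. *)
Lemma near_rho0P rho : `|rho - rho0 R| <= 5 / 10 ^+ 8 -> exists d,
  [/\ rho = rho0 R + d, - (5 / 10 ^+ 8) <= d <= 5 / 10 ^+ 8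
    & forall n, - (1 / 10 ^+ 14) <= d ^+ n.+2 <= 1 / 10 ^+ 14].
Proof.
move=> h; exists (rho - rho0 R); split; first by rewrite addrC subrK.
  by rewrite -ler_norml.
move: (rho - rho0 R) h => d h n; rewrite -ler_norml normrX -addn2 exprD.
have h1 : `|d| <= 1 by apply: (le_trans h); lra.
have h2 : `|d| ^+ 2 <= (5 / 10 ^+ 8) ^+ 2 by rewrite lerXn2r ?nnegrE // divr_ge0.
apply: (@le_trans _ _ (`|d| ^+ 2)); first by rewrite ler_piMl // exprn_ile1.
by apply: (le_trans h2); lra.
Qed.

(** The point is a palindrome while the second and fourth decimals differ by one unit; their common
    value lies strictly between the two. *)
Lemma extremal_near rho : `|rho - rho0 R| <= 5 / 10 ^+ 8 -> forall k : 'I_5,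
  `|extremal rho 0 k - dec7 R (nth 0%N
     [:: 2114174; 5028452; 6363167; 5028451; 2114174]%N k)| < dec7 R 1.
Proof.
move=> h; have rI := near_rho0_in_range h.
have n0 : 0 < normpoly rho by apply: normpoly_gt0; case/andP: rI => /andP[].
have [d [E d1 dn]] := near_rho0P h.
have d2 := dn 0%N; have d3 := dn 1%N; have d4 := dn 2%N.
have /andP[r0 r1] := in_range_bounds rI.
have p0 k : 0 < kernelpoly rho (nat_of_ord (k : 'I_5)).
  by case: k => [[|[|[|[|[|//]]]]]] i; rewrite /kernelpoly /=; nra.
clear dn h rI.
case=> [[|[|[|[|[|//]]]]]] i; rewrite mxE;
  (apply: div_sqrt_near; [exact: p0 | exact: n0 | |]);
  rewrite ?E /dec7 /kernelpoly /normpoly /rho0; cbn [nth nat_of_ord];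
  clear -d1 d2 d3 d4; lra.
Qed.

Lemma extremal_coefs_near rho : `|rho - rho0 R| <= 5 / 10 ^+ 8 ->
  forall k : 'I_5, k != 0 ->
  `|cospoly_of (extremal rho) 0 k - dec7 R (nth 0%N
     [:: 10000000; 17051159; 10438202; 4252409; 893946]%N k)| < dec7 R 1.
Proof.
move=> h; have rI := near_rho0_in_range h.
have r0 : 0 <= rho by case/andP: rI => /andP[].
have n0 : 0 < normpoly rho by exact: normpoly_gt0.
have [d [E d1 dn]] := near_rho0P h.
have d2 := dn 0%N; have d3 := dn 1%N; have d4 := dn 2%N.
have [_ f1 f2 f3 f4] := extremal_coefs r0.
have K k (j : 'I_5) : j = k :> nat ->
    cospoly_of (extremal rho) 0 k = cospoly_of (extremal rho) 0 j.
  by move=> jk; congr (_ 0 _); apply/val_inj.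
clear dn h rI.
case=> [[|[|[|[|[|//]]]]]] i // _.
- rewrite (K _ 1) // f1; apply: div_near => //.
  rewrite E /dec7 /coefpoly /normpoly /rho0; cbn [nth nat_of_ord].
  clear -d1 d2 d3 d4; lra.
- rewrite (K _ 2) // f2; apply: div_near => //.
  rewrite E /dec7 /kernelpoly /normpoly /rho0; cbn [nth nat_of_ord].
  clear -d1 d2 d3 d4; lra.
- rewrite (K _ 3) // f3; apply: div_near => //.
  rewrite E /dec7 /kernelpoly /normpoly /rho0; cbn [nth nat_of_ord].
  clear -d1 d2 d3 d4; lra.
- rewrite (K _ 4) // f4; apply: div_near => //.
  rewrite E /dec7 /kernelpoly /normpoly /rho0; cbn [nth nat_of_ord].
  clear -d1 d2 d3 d4; lra.
Qed.

Lemma inf_attained (A : set R) v : A v -> lbound A v -> inf A = v.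
Proof.
move=> Av lb; apply/eqP; rewrite eq_le lb_le_inf ?andbT //; last by exists v.
by apply: ge_inf => //; exists v.
Qed.

Lemma itv_ccE (l u v : R) : `[l, u]%classic v = (l <= v <= u) :> Prop.
Proof. by rewrite /= in_itv. Qed.

(** The triple angle formula at [cos (pi / 2) = 0] gives [4 * c ^+ 3 = 3 * c]. *)
Lemma cos_pi6 : 2 * cos (pi / 6) = Num.sqrt 3 :> R.
Proof.
set c := cos _; have pi0 := pi_gt0 R.
have c0 : 0 < c by apply: cos_gt0_pihalf; apply/andP; split; lra.
have : cos (3 * (pi / 6) : R) = 4 * c ^+ 3 - 3 * c.
  rewrite (_ : 3 * (pi / 6) = (pi / 6) *+ 2 + pi / 6); last by field.
  rewrite cosD cos_mulr2n sin_mulr2n -/c.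
  rewrite (_ : c * sin (pi / 6) *+ 2 * sin (pi / 6) = 2 * c * sin (pi / 6) ^+ 2).
    by rewrite sin2cos2 -/c; ring.
  by ring.
rewrite (_ : 3 * (pi / 6) = pi / 2); last by field.
rewrite cos_pihalf => h.
have c2 : (2 * c) ^+ 2 = 3.
  by apply: (mulfI (lt0r_neq0 c0)); rewrite mulrC; lra.
by rewrite -c2 sqrtr_sqr ger0_norm // mulr_ge0 // ltW.
Qed.

(** [vn] is invariant under positive scaling, so division by [a_0] reduces to [a_0 = 1]. *)
Lemma vn_ge V : V <= v0 R -> (forall t, in_range t -> V <= ratio t) ->
  forall g, Cn R 4 g -> V <= vn g.
Proof.
move=> V_le V_min g [g_coef [g0 g1] g_ge0].
rewrite /vn; rewrite /Defs.coef1 (_ : inord 1 = 1) in g1 *; last first.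
  by apply/val_inj; rewrite /= inordK.
pose f : 'rV[R]_5 := (g 0 0)^-1 *: g.
have fE phi : cos_eval f phi = (g 0 0)^-1 * cos_eval g phi.
  by rewrite !cos_eval5 !mxE; ring.
have f00 : f 0 0 = 1 by rewrite mxE mulVf // gt_eqF.
have f01 : f 0 1 = g 0 1 / g 0 0 by rewrite mxE mulrC.
have f1 : 1 < f 0 1 by rewrite f01 ltr_pdivlMr // mul1r.
have f_ge0 phi : 0 <= cos_eval f phi by rewrite fE mulr_ge0 // invr_ge0 ltW.
have f_coef k : 0 <= f 0 k by rewrite mxE mulr_ge0 // invr_ge0 ltW.
have := value_ge_V_coef V_le V_min f_ge0 f00 f_coef (ltW f1).
have -> : Num.sqrt (g 0 1) = Num.sqrt (f 0 1) * Num.sqrt (g 0 0).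
  by rewrite -sqrtrM ?(ltW (lt_trans _ f1)) // f01 divfK // gt_eqF.
have -> : (Num.sqrt (f 0 1) * Num.sqrt (g 0 0) - Num.sqrt (g 0 0)) ^+ 2 =
    (Num.sqrt (f 0 1) - 1) ^+ 2 * g 0 0.
  by rewrite -[in RHS](sqr_sqrtr (ltW g0)); ring.
have s0 : 0 < (Num.sqrt (f 0 1) - 1) ^+ 2.
  by rewrite exprn_gt0 // subr_gt0 -[ltLHS]sqrtr1 ltr_sqrt // (lt_trans _ f1).
rewrite ler_pdivlMr; last exact: mulr_gt0.
have -> : cos_eval g 0 - g 0 0 = (cos_eval f 0 - 1) * g 0 0.
  by rewrite fE mulrBl mul1r mulrAC mulVf ?gt_eqF // mul1r.
by move=> h; rewrite mulrA ler_pM2r.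
Qed.

End Extremal.

Theorem theorem4p4 (R : realType) :
  let I : set R := `[dec7 R 15597515, 2 * cos (pi / 6)]%classic in
  let q (a : R) := p2 a / (Num.sqrt a - 1) ^+ 2 in
  [/\ Vn R 4 = inf [set q a | a in I],
      `|Vn R 4 - dec7 R 348992259| <= dec7 R 1 / 2
    & exists x : 'rV[R]_5,
      let f : 'rV[R]_5 := cospoly_of x in
      let a : R := f 0 1 in
      [/\ forall k : 'I_5,
            `|x 0 k - dec7 R (nth 0%N
               [:: 2114174; 5028452; 6363167; 5028451; 2114174]%N k)| < dec7 R 1,
          [/\ I a, feasible a x, F x = p2 a & q a = inf [set q b | b in I]],
          f 0 0 = 1,
          forall k : 'I_5, k != 0 ->
            `|f 0 k - dec7 R (nth 0%N
               [:: 10000000; 17051159; 10438202; 4252409; 893946]%N k)| < dec7 R 1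
        & Cn R 4 f /\ vn f = Vn R 4]].
Proof.
move=> I q.
have [rho [rI rn /andP[vl vh] rmin]] := ratio_min R.
have r0 : 0 <= rho by case/andP: rI => /andP[].
have xf := extremal_feasible r0; set x := extremal rho in xf *.
have [f0 f1 fF] := cospoly_of_feasible xf.
set a := coefpoly rho / normpoly rho in xf f1.
have a1 : 5 / 3 <= a := coef_ge rI.
have a3 : a <= Num.sqrt 3.
  by rewrite -f1; apply: coef1_le_sqrt3 => //; exact: cospoly_of_ge0.
(* The lower end of [I] lies between 3/2 and 5/3: below [a] here, and high enough for [value_ge_V]
   in [inf_q]. *)
have Ia : I a.
  rewrite /I itv_ccE cos_pi6 a3 andbT; apply: le_trans a1.
  by rewrite /dec7; lra.
have Fx : F x = p2 a.
  apply/esym/p2_eq => // y yf; have [g0 g1 gF] := cospoly_of_feasible yf.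
  rewrite F_extremal // lerBlDr -gF.
  by apply: value_ge_curve => //; exact: cospoly_of_ge0.
have qa : q a = ratio rho by rewrite /q -Fx F_extremal.
have inf_q : inf [set q b | b in I] = ratio rho.
  apply: inf_attained; first by exists a.
  move=> _ [b Ib <-]; move: Ib; rewrite /I itv_ccE cos_pi6 => /andP[b1 b3].
  have b2 : 3 / 2 <= b by apply: le_trans b1; rewrite /dec7; lra.
  have [|y yf yF] := @p2_attained R b; first by rewrite b2.
  have [g0 g1 gF] := cospoly_of_feasible yf.
  have := value_ge_V vh rmin (@cospoly_of_ge0 R y) g0.
  rewrite g1 gF addrK yF => /(_ b2); rewrite /q ler_pdivlMr //.
  by rewrite exprn_gt0 // subr_gt0 -[ltLHS]sqrtr1 ltr_sqrt; lra.
have inf_V : Vn R 4 = ratio rho.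
  apply: inf_attained.
    exists (cospoly_of x); [exact: extremal_in_Cn | exact: vn_extremal].
  by move=> _ [g gC <-]; exact: vn_ge gC.
split; first by rewrite inf_V inf_q.
  rewrite inf_V ler_distl; move: (ratio rho) vl vh => v vl vh.
  by rewrite /dec7; apply/andP; split;
    [apply: (le_trans _ vl); rewrite /v1 | apply: (le_trans vh); rewrite /v0];
    clear; lra.
exists x; split.
- exact: extremal_near.
- by rewrite /= f1; split => //; rewrite inf_q.
- exact: f0.
- exact: extremal_coefs_near.
- by split; [exact: extremal_in_Cn | rewrite inf_V; exact: vn_extremal].
Qed.
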